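(* Let $X$ be a countable $\aleph_0$-space. Then $C_c(X)$ endowed with its weak topology $\sigma(C_c(X),C_c(X)')$ is an $\aleph_0$-space.
   Context: $C_c(X)$ is the space of continuous real functions on $X$ with the compact-open topology; its dual can be identified with the regular Borel measures on $X$ with compact support. A $k$-network is a family $\mathcal N$ such that whenever $K\subset U$ with $K$ compact and $U$ open, there is a finite $\mathcal F\subset\mathcal N$ with $K\subset\bigcup\mathcal F\subset U$; an $\aleph_0$-space is a regular space with a countable $k$-network. *)

(* Defs.v *)
From Stdlib Require Export Reals List.
Export ListNotations.
Open Scope R_scope.

Definition is_topology {X : Type} (op : (X -> Prop) -> Prop) : Prop :=
  op (fun _ => True) /\
  (forall U V, op U -> op V -> op (fun x => U x /\ V x)) /\
  (forall F : (X -> Prop) -> Prop, (forall U, F U -> op U) ->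
     op (fun x => exists U, F U /\ U x)).

Definition compact {X : Type} (op : (X -> Prop) -> Prop) (K : X -> Prop) : Prop :=
  forall F : (X -> Prop) -> Prop,
    (forall U, F U -> op U) ->
    (forall x, K x -> exists U, F U /\ U x) ->
    exists l : list (X -> Prop),
      (forall U, In U l -> F U) /\ (forall x, K x -> exists U, In U l /\ U x).

(* Regular space (T3 = T1 + regular, as in Engelking). *)
Definition regular_space {X : Type} (op : (X -> Prop) -> Prop) : Prop :=
  (forall x y : X, x <> y -> exists U, op U /\ U x /\ ~ U y) /\
  (forall (x : X) (U : X -> Prop), op U -> U x ->
     exists V, op V /\ V x /\
       (forall y, (forall W, op W -> W y -> exists z, W z /\ V z) -> U y)).

Definition k_network {X : Type} (op : (X -> Prop) -> Prop)
    (N : (X -> Prop) -> Prop) : Prop :=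
  forall K U : X -> Prop, compact op K -> op U -> (forall x, K x -> U x) ->
    exists l : list (X -> Prop),
      (forall A, In A l -> N A) /\
      (forall x, K x -> exists A, In A l /\ A x) /\
      (forall A, In A l -> forall x, A x -> U x).

Definition countable_family {X : Type} (N : (X -> Prop) -> Prop) : Prop :=
  exists f : nat -> (X -> Prop), forall A, N A -> exists n, f n = A.

Definition aleph0_space {X : Type} (op : (X -> Prop) -> Prop) : Prop :=
  regular_space op /\ exists N, countable_family N /\ k_network op N.

Definition countable_type (X : Type) : Prop :=
  exists f : X -> nat, forall x y, f x = f y -> x = y.

Definition generated {Y : Type} (S : (Y -> Prop) -> Prop) (W : Y -> Prop) : Prop :=
  forall y, W y -> exists l : list (Y -> Prop),
    (forall A, In A l -> S A) /\ (forall A, In A l -> A y) /\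
    (forall z, (forall A, In A l -> A z) -> W z).

Definition R_open (U : R -> Prop) : Prop :=
  forall x, U x -> exists eps, 0 < eps /\ forall y, Rabs (y - x) < eps -> U y.

Definition continuous_map {X Y : Type} (opX : (X -> Prop) -> Prop)
    (opY : (Y -> Prop) -> Prop) (f : X -> Y) : Prop :=
  forall V, opY V -> opX (fun x => V (f x)).

Definition CX {X : Type} (op : (X -> Prop) -> Prop) : Type :=
  { f : X -> R | continuous_map op R_open f }.

Definition compact_open {X : Type} (op : (X -> Prop) -> Prop) :
    (CX op -> Prop) -> Prop :=
  generated (fun A : CX op -> Prop =>
    exists K U, compact op K /\ R_open U /\
      forall f, A f <-> (forall x, K x -> U (proj1_sig f x))).

Definition linear_functional {X : Type} (op : (X -> Prop) -> Prop)
    (phi : CX op -> R) : Prop :=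
  forall (f g h : CX op) (a b : R),
    (forall x, proj1_sig h x = a * proj1_sig f x + b * proj1_sig g x) ->
    phi h = a * phi f + b * phi g.

Definition dual_Cc {X : Type} (op : (X -> Prop) -> Prop) (phi : CX op -> R) : Prop :=
  linear_functional op phi /\ continuous_map (compact_open op) R_open phi.

Definition weak_topology_Cc {X : Type} (op : (X -> Prop) -> Prop) :
    (CX op -> Prop) -> Prop :=
  generated (fun A : CX op -> Prop =>
    exists phi V, dual_Cc op phi /\ R_open V /\
      forall f, A f <-> V (phi f)).

(* Main.v *)
From Stdlib Require Import Lra Lia Classical IndefiniteDescription.
From Stdlib Require Import FunctionalExtensionality PropExtensionality ProofIrrelevance Cantor.
From Coquelicot Require Import Coquelicot.
Require Import Defs.

(** A continuous functional [phi] on C_c(X) is bounded by a multiple of the supremum over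
    some compact [K]. Since [X] is countable, bounded convergence for the variation of [phi]
    shows that, on functions bounded by [M] on [K], [phi] is continuous for pointwise
    convergence; the Riesz representation is not needed.

    A weakly compact set [H] is weakly bounded, hence uniformly bounded on every compact
    set (gliding hump). It is even bounded on some set [A] containing [K] that is a finite
    intersection of finite unions of members of the given k-network: otherwise pick points
    [x n], in smaller and smaller such [A], at which [H] is larger and larger; then [K]
    together with all [x n] is compact, a contradiction. So if a weakly open [U] contains
    [H] and [f] is in [H], then [U] contains all [g] that are bounded by [M] on finitely
    many such [A] and rationally close to [f] at finitely many points. These countably many
    sets of functions form a k-network: finitely many of the pointwise conditions cover [H]
    by compactness, and [H] satisfies the boundedness conditions. *)

Set Bullet Behavior "Strict Subproofs".

Local Notation val := proj1_sig.

Ltac split_Rabs_max :=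
  unfold Rmax, Rmin, Rabs in *;
  repeat match goal with
  | |- context [Rle_dec ?a ?b] => destruct (Rle_dec a b)
  | |- context [Rcase_abs ?a] => destruct (Rcase_abs a)
  | H : context [Rle_dec ?a ?b] |- _ => destruct (Rle_dec a b)
  | H : context [Rcase_abs ?a] |- _ => destruct (Rcase_abs a)
  end; try lra.

(** * Topological preliminaries *)

Lemma set_ext {X : Type} (A B : X -> Prop) : (forall x, A x <-> B x) -> A = B.
Proof.
  intro H. apply functional_extensionality. intro x.
  apply propositional_extensionality. apply H.
Qed.

Lemma open_of_local {X : Type} (op : (X -> Prop) -> Prop) (U : X -> Prop) :
  is_topology op ->
  (forall x, U x -> exists O, op O /\ O x /\ forall y, O y -> U y) -> op U.
Proof.
  intros [_ [_ Hun]] H.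
  rewrite (set_ext U (fun x => exists O, (op O /\ forall y, O y -> U y) /\ O x)).
  - apply Hun. tauto.
  - intro x. split.
    + intro Hx. destruct (H x Hx) as [O [HO [Ox OU]]]. exists O. tauto.
    + intros [O [[_ OU] Ox]]. auto.
Qed.

Lemma compact_singleton {X : Type} (op : (X -> Prop) -> Prop) (x : X) :
  compact op (fun y => y = x).
Proof.
  intros F HF Hc. destruct (Hc x eq_refl) as [U [FU Ux]].
  exists [U]. split.
  - intros V [<-|[]]; exact FU.
  - intros y ->. exists U. simpl; auto.
Qed.

Lemma compact_empty {X : Type} (op : (X -> Prop) -> Prop) :
  compact op (fun _ => False).
Proof.
  intros F HF Hc. exists nil. split; intros ? [].
Qed.

Lemma compact_union {X : Type} (op : (X -> Prop) -> Prop) (K L : X -> Prop) :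
  compact op K -> compact op L -> compact op (fun x => K x \/ L x).
Proof.
  intros HK HL F HF Hc.
  destruct (HK F HF) as [l [Hl1 Hl2]]; [intros; apply Hc; auto|].
  destruct (HL F HF) as [m [Hm1 Hm2]]; [intros; apply Hc; auto|].
  exists (l ++ m). split.
  - intros U HU. apply in_app_or in HU. destruct HU; auto.
  - intros x [Hx|Hx]; [destruct (Hl2 x Hx) as [U [? ?]] | destruct (Hm2 x Hx) as [U [? ?]]];
    exists U; split; auto; apply in_or_app; auto.
Qed.

(** The complement of [A] is added to the cover and discarded again from the finite subcover. *)
Lemma compact_inter_closed {X : Type} (op : (X -> Prop) -> Prop) (K A : X -> Prop) :
  compact op K -> op (fun x => ~ A x) -> compact op (fun x => K x /\ A x).
Proof.
  intros HK HA F HF Hc.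
  destruct (HK (fun U => F U \/ U = (fun x => ~ A x))) as [l [Hl1 Hl2]].
  - intros U [HU| ->]; auto.
  - intros x Hx. destruct (classic (A x)) as [Ax|Ax].
    + destruct (Hc x) as [U [? ?]]; auto. exists U; auto.
    + exists (fun x => ~ A x); auto.
  - assert (Hf : exists m, forall U, In U m <-> In U l /\ F U).
    { clear Hl1 Hl2. induction l as [|U l [m Hm]].
      - exists nil. simpl. tauto.
      - destruct (classic (F U)) as [FU|FU].
        + exists (U :: m). intro V. simpl. rewrite Hm.
          split; intuition; subst; auto.
        + exists m. intro V. rewrite Hm. simpl.
          split; intuition; subst; tauto. }
    destruct Hf as [m Hm]. exists m. split.
    + intros U HU. apply Hm, HU.
    + intros x [Kx Ax]. destruct (Hl2 x Kx) as [U [HU Ux]].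
      exists U. split; auto. apply Hm. split; auto.
      destruct (Hl1 U HU) as [FU| ->]; auto. contradiction.
Qed.

(** Stated for a bare function with open sublevel sets, so that it serves both continuous functions
    on [X] and functionals on weakly compact sets. *)
Lemma compact_bounded {X : Type} (op : (X -> Prop) -> Prop) (K : X -> Prop) (f : X -> R) :
  compact op K -> (forall n, op (fun x => Rabs (f x) < INR n)) ->
  exists M, 0 <= M /\ forall x, K x -> Rabs (f x) <= M.
Proof.
  intros HK Hf.
  destruct (HK (fun U => exists n, U = (fun x => Rabs (f x) < INR n))) as [l [Hl1 Hl2]].
  - intros U [n ->]. apply Hf.
  - intros x _. destruct (INR_unbounded (Rabs (f x))) as [n Hn].
    exists (fun x => Rabs (f x) < INR n). split; [exists n; auto | lra].
  - assert (HM : exists M, 0 <= M /\ forall U, In U l -> forall x, U x -> Rabs (f x) <= M).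
    { clear Hl2. induction l as [|U l IH].
      - exists 0. split; [lra|]. intros U [].
      - destruct IH as [M [HM0 HM]]; [intros; apply Hl1; simpl; auto|].
        destruct (Hl1 U) as [n Hn]; [simpl; auto|].
        exists (Rmax M (INR n)). split; [apply Rle_trans with M; auto using Rmax_l|].
        intros V [<-|HV] x Vx.
        + rewrite Hn in Vx. pose proof (Rmax_r M (INR n)). lra.
        + pose proof (Rmax_l M (INR n)). pose proof (HM V HV x Vx). lra. }
    destruct HM as [M [HM0 HM]]. exists M. split; auto.
    intros x Kx. destruct (Hl2 x Kx) as [U [HU Ux]]. eauto.
Qed.

Lemma R_open_ball (c r : R) : R_open (fun y => Rabs (y - c) < r).
Proof.
  intros x Hx. exists (r - Rabs (x - c)). split; [lra|].
  intros y Hy. replace (y - c) with ((y - x) + (x - c)) by ring.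
  pose proof (Rabs_triang (y - x) (x - c)). lra.
Qed.

Lemma R_open_outside (c r : R) : R_open (fun y => ~ Rabs (y - c) <= r).
Proof.
  intros x Hx. exists (Rabs (x - c) - r). split; [lra|].
  intros y Hy. split_Rabs_max.
Qed.

Lemma generated_topology {Y : Type} (S : (Y -> Prop) -> Prop) : is_topology (generated S).
Proof.
  split; [|split].
  - intros y _. exists nil. simpl. tauto.
  - intros U V HU HV y [Uy Vy].
    destruct (HU y Uy) as [l [Hl1 [Hl2 Hl3]]]. destruct (HV y Vy) as [m [Hm1 [Hm2 Hm3]]].
    exists (l ++ m). split; [|split].
    + intros A HA. apply in_app_or in HA. destruct HA; auto.
    + intros A HA. apply in_app_or in HA. destruct HA as [HA|HA]; [apply (Hl2 A HA) | apply (Hm2 A HA)].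
    + intros z Hz. split; [apply Hl3 | apply Hm3]; intros; apply Hz; apply in_or_app; auto.
  - intros F HF y [U [FU Uy]]. destruct (HF U FU y Uy) as [l [? [? ?]]].
    exists l. split; [|split]; auto. intros z Hz. exists U. auto.
Qed.

Lemma generated_subbasic {Y : Type} (S : (Y -> Prop) -> Prop) (A : Y -> Prop) :
  S A -> generated S A.
Proof.
  intros HA y Ay. exists [A]. split; [|split].
  - intros B [<-|[]]; auto.
  - intros B [<-|[]]; auto.
  - intros z Hz. apply Hz. simpl; auto.
Qed.

(** * Operations on continuous functions *)

(** This condition yields linear combinations, maxima, minima and truncations as continuous
    functions by a single argument. *)
Definition lipschitz2 (F : R -> R -> R) : Prop :=
  exists L, 0 < L /\ forall a b c d,
    Rabs (F a b - F c d) <= L * (Rabs (a - c) + Rabs (b - d)).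

Lemma continuous_local {X : Type} (op : (X -> Prop) -> Prop) (f : X -> R) :
  is_topology op ->
  (continuous_map op R_open f <->
   forall x eps, 0 < eps ->
     exists O, op O /\ O x /\ forall y, O y -> Rabs (f y - f x) < eps).
Proof.
  intro T. split.
  - intros Hf x eps He. exists (fun y => Rabs (f y - f x) < eps). split; [|split]; auto.
    + apply (Hf _ (R_open_ball (f x) eps)).
    + rewrite Rminus_diag, Rabs_R0. exact He.
  - intros Hf V HV. apply open_of_local; [exact T|].
    intros x Vx. destruct (HV _ Vx) as [e [He HVe]].
    destruct (Hf x e He) as [O [HO [Ox HOe]]].
    exists O. split; [|split]; auto.
Qed.

Lemma continuous_lipschitz2 {X : Type} (op : (X -> Prop) -> Prop) (T : is_topology op)
    (F : R -> R -> R) (HF : lipschitz2 F) (f g : CX op) :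
  continuous_map op R_open (fun x => F (val f x) (val g x)).
Proof.
  apply continuous_local; [exact T|].
  destruct HF as [L [HL HF]]. intros x eps He.
  assert (He' : 0 < eps / (2 * L)) by (apply Rdiv_lt_0_compat; lra).
  destruct (proj1 (continuous_local op _ T) (proj2_sig f) x _ He') as [O [HO [Ox HOf]]].
  destruct (proj1 (continuous_local op _ T) (proj2_sig g) x _ He') as [P [HP [Px HPg]]].
  exists (fun y => O y /\ P y). split; [|split; auto].
  - apply T; auto.
  - intros y [Oy Py]. eapply Rle_lt_trans; [apply HF|].
    specialize (HOf y Oy). specialize (HPg y Py).
    apply Rlt_le_trans with (L * (eps / (2 * L) + eps / (2 * L))).
    + apply Rmult_lt_compat_l; lra.
    + apply Req_le. field. lra.
Qed.

Definition comb {X : Type} (op : (X -> Prop) -> Prop) (T : is_topology op)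
    (F : R -> R -> R) (HF : lipschitz2 F) (f g : CX op) : CX op :=
  exist _ (fun x => F (val f x) (val g x)) (continuous_lipschitz2 op T F HF f g).

Lemma continuous_const {X : Type} (op : (X -> Prop) -> Prop) (T : is_topology op) (c : R) :
  continuous_map op R_open (fun _ : X => c).
Proof.
  apply continuous_local; [exact T|]. intros x eps He.
  exists (fun _ => True). split; [apply T|split]; auto.
  intros. rewrite Rminus_diag, Rabs_R0. exact He.
Qed.

Definition const_CX {X : Type} (op : (X -> Prop) -> Prop) (T : is_topology op) (c : R) : CX op :=
  exist _ (fun _ => c) (continuous_const op T c).

Lemma lipschitz2_lin (a b : R) : lipschitz2 (fun s t => a * s + b * t).
Proof.
  exists (Rabs a + Rabs b + 1). pose proof (Rabs_pos a). pose proof (Rabs_pos b).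
  split; [lra|]. intros s t u v.
  replace (a * s + b * t - (a * u + b * v)) with (a * (s - u) + b * (t - v)) by ring.
  eapply Rle_trans; [apply Rabs_triang|]. rewrite !Rabs_mult.
  pose proof (Rabs_pos (s - u)). pose proof (Rabs_pos (t - v)). nra.
Qed.

Lemma lipschitz2_max : lipschitz2 Rmax.
Proof. exists 1. split; [lra|]. intros. split_Rabs_max. Qed.

Lemma lipschitz2_min : lipschitz2 Rmin.
Proof. exists 1. split; [lra|]. intros. split_Rabs_max. Qed.

(** For [t >= 0] this truncates [s] to the interval [[-t, t]]; it provides the Riesz decomposition
    below. *)
Lemma lipschitz2_clamp : lipschitz2 (fun s t => Rmax (- t) (Rmin s t)).
Proof. exists 1. split; [lra|]. intros. split_Rabs_max. Qed.

Lemma lipschitz2_abs : lipschitz2 (fun s _ => Rabs s).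
Proof. exists 1. split; [lra|]. intros. split_Rabs_max. Qed.

Definition lin_CX {X : Type} (op : (X -> Prop) -> Prop) (T : is_topology op) (a b : R) :=
  comb op T _ (lipschitz2_lin a b).
Definition max_CX {X : Type} (op : (X -> Prop) -> Prop) (T : is_topology op) :=
  comb op T _ lipschitz2_max.
Definition min_CX {X : Type} (op : (X -> Prop) -> Prop) (T : is_topology op) :=
  comb op T _ lipschitz2_min.
Definition clamp_CX {X : Type} (op : (X -> Prop) -> Prop) (T : is_topology op) :=
  comb op T _ lipschitz2_clamp.
Definition abs_CX {X : Type} (op : (X -> Prop) -> Prop) (T : is_topology op) (f : CX op) :=
  comb op T _ lipschitz2_abs f f.

Lemma CX_bounded {X : Type} (op : (X -> Prop) -> Prop) (K : X -> Prop) (f : CX op) :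
  compact op K -> exists M, 0 <= M /\ forall x, K x -> Rabs (val f x) <= M.
Proof.
  intro HK. apply compact_bounded with op; auto.
  intro n. pose proof (proj2_sig f _ (R_open_ball 0 (INR n))) as H. simpl in H.
  erewrite set_ext; [exact H|]. intro x. simpl. rewrite Rminus_0_r. tauto.
Qed.

(** * Continuous linear functionals *)

(** Quantifying over all bounds [s] avoids forming the supremum of [|h|] on [K]. *)
Definition bounded_on {X : Type} (op : (X -> Prop) -> Prop) (K : X -> Prop) (C : R)
    (phi : CX op -> R) : Prop :=
  forall h s, 0 < s -> (forall x, K x -> Rabs (val h x) <= s) -> Rabs (phi h) <= C * s.

Lemma linear_opp {X : Type} (op : (X -> Prop) -> Prop) (phi : CX op -> R) (f g : CX op) :
  linear_functional op phi -> (forall x, val g x = - val f x) -> phi g = - phi f.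
Proof.
  intros Hl H. rewrite (Hl f f g (-1) 0); [ring|]. intro x. rewrite H. ring.
Qed.

Lemma linear_sub {X : Type} (op : (X -> Prop) -> Prop) (phi : CX op -> R) (f g h : CX op) :
  linear_functional op phi -> (forall x, val h x = val f x - val g x) -> phi h = phi f - phi g.
Proof.
  intros Hl H. rewrite (Hl f g h 1 (-1)); [ring|]. intro x. rewrite H. ring.
Qed.

Lemma linear_add {X : Type} (op : (X -> Prop) -> Prop) (phi : CX op -> R) (f g h : CX op) :
  linear_functional op phi -> (forall x, val h x = val f x + val g x) -> phi h = phi f + phi g.
Proof.
  intros Hl H. rewrite (Hl f g h 1 1); [ring|]. intro x. rewrite H. ring.
Qed.

(** A neighbourhood of zero on which [|phi| < 1] contains every function smaller than some [d] on
    some compact [K]; scaling then yields the constant [2 / d]. *)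
Lemma dual_bounded_on {X : Type} (op : (X -> Prop) -> Prop) (T : is_topology op)
    (phi : CX op -> R) :
  dual_Cc op phi -> exists K C, compact op K /\ 0 < C /\ bounded_on op K C phi.
Proof.
  intros [Hl Hc]. set (z := const_CX op T 0).
  assert (Hz : phi z = 0).
  { rewrite (linear_sub op phi z z z Hl); [ring|]. intro. simpl. ring. }
  destruct (Hc _ (R_open_ball 0 1) z) as [l [Hl1 [Hl2 Hl3]]].
  { rewrite Hz, Rminus_diag, Rabs_R0. lra. }
  assert (HK : exists K d, compact op K /\ 0 < d /\
    forall h, (forall x, K x -> Rabs (val h x) < d) -> forall A, In A l -> A h).
  { clear Hl3. induction l as [|A l IH].
    - exists (fun _ => False), 1. split; [apply compact_empty|]. split; [lra|].
      intros h _ A [].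
    - destruct IH as [K [d [HK [Hd H]]]];
        [intros; apply Hl1; simpl; auto | intros; apply Hl2; simpl; auto|].
      destruct (Hl1 A) as [L [U [HL [HU HA]]]]; [simpl; auto|].
      assert (HLd : exists e, 0 < e /\
        forall h, (forall x, L x -> Rabs (val h x) < e) -> A h).
      (* A point of [L] shows that [0] lies in [U], because [z] is in [A]; if [L] is empty, every
         function is in [A]. *)
      { destruct (classic (exists x, L x)) as [[x0 Lx0]|Hn].
        - assert (U0 : U 0).
          { apply (proj1 (HA z) (Hl2 A (or_introl eq_refl)) x0 Lx0). }
          destruct (HU 0 U0) as [e [He HUe]]. exists e. split; auto.
          intros h Hh. apply HA. intros x Lx. apply HUe. rewrite Rminus_0_r. auto.
        - exists 1. split; [lra|]. intros h _. apply HA. intros x Lx.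
          exfalso. eauto. }
      destruct HLd as [e [He HAe]].
      exists (fun x => K x \/ L x), (Rmin d e).
      split; [apply compact_union; auto|]. split; [apply Rmin_pos; auto|].
      intros h Hh B [<-|HB].
      + apply HAe. intros x Lx. pose proof (Rmin_r d e). specialize (Hh x (or_intror Lx)). lra.
      + apply H; auto. intros x Kx. pose proof (Rmin_l d e).
        specialize (Hh x (or_introl Kx)). lra. }
  destruct HK as [K [d [HK [Hd H]]]].
  exists K, (2 / d). split; auto. split; [apply Rdiv_lt_0_compat; lra|].
  (* The factor [t] scales the bound [s] to [d / 2], strictly below [d]. *)
  intros h s Hs Hh. set (t := d / (2 * s)).
  assert (Ht : 0 < t) by (apply Rdiv_lt_0_compat; lra).
  assert (Hp : Rabs (phi (lin_CX op T t 0 h h) - 0) < 1).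
  { apply Hl3. apply H. intros x Kx. simpl. rewrite Rmult_0_l, Rplus_0_r, Rabs_mult.
    rewrite (Rabs_pos_eq t) by lra.
    apply Rle_lt_trans with (t * s).
    - apply Rmult_le_compat_l; [lra|auto].
    - unfold t. replace (d / (2 * s) * s) with (d / 2) by (field; lra). lra. }
  rewrite (Hl h h _ t 0) in Hp by reflexivity.
  rewrite Rmult_0_l, Rplus_0_r, Rminus_0_r, Rabs_mult, (Rabs_pos_eq t) in Hp by lra.
  replace (2 / d * s) with (1 / t) by (unfold t; field; lra).
  apply Rmult_le_reg_l with t; auto. replace (t * (1 / t)) with 1 by (field; lra). lra.
Qed.

(* The subbasic sets of the compact-open topology are not uniform balls: the ball
   around [f] is recovered by cutting [K] into finitely many compact pieces on
   which [f] is almost constant. *)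
Lemma compact_open_ball {X : Type} (op : (X -> Prop) -> Prop) (K : X -> Prop) (f : CX op)
    (eps : R) :
  compact op K -> 0 < eps ->
  exists W, compact_open op W /\ W f /\
    forall g, W g -> forall x, K x -> Rabs (val g x - val f x) <= eps.
Proof.
  intros HK He. set (e := eps / 4).
  assert (He' : 0 < e) by (unfold e; lra).
  destruct (HK (fun U => exists a, U = (fun x => Rabs (val f x - a) < e))) as [l [Hl1 Hl2]].
  - intros U [a ->]. apply (proj2_sig f _ (R_open_ball a e)).
  - intros x Kx. exists (fun y => Rabs (val f y - val f x) < e). split; [eexists; reflexivity|].
    rewrite Rminus_diag, Rabs_R0. exact He'.
  - assert (HW : exists W, compact_open op W /\ W f /\ forall g, W g -> forall U, In U l ->
        forall x, K x -> U x -> Rabs (val g x - val f x) <= eps).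
    { clear Hl2. induction l as [|U l IH].
      - exists (fun _ => True). split; [apply generated_topology|]. split; auto.
        intros g _ U [].
      - destruct IH as [W [HW [Wf HWg]]]; [intros; apply Hl1; simpl; auto|].
        destruct (Hl1 U) as [a Ha]; [simpl; auto|].
        (* On the compact piece where [f] is within [e] of [a], [g] is kept within [2 * e] of [a],
           so [|g - f| < 3 * e < eps] there. *)
        exists (fun g => W g /\
          forall x, K x /\ Rabs (val f x - a) <= e -> Rabs (val g x - a) < 2 * e).
        split; [|split].
        + apply generated_topology; auto. apply generated_subbasic.
          exists (fun x => K x /\ Rabs (val f x - a) <= e), (fun y => Rabs (y - a) < 2 * e).
          split; [|split; [apply R_open_ball | tauto]].
          apply compact_inter_closed; auto. apply (proj2_sig f _ (R_open_outside a e)).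
        + split; auto. intros x [_ H]. lra.
        + intros g [Wg Hg] V [<-|HV] x Kx Vx; [|eapply HWg; eauto].
          rewrite Ha in Vx. specialize (Hg x (conj Kx (Rlt_le _ _ Vx))).
          unfold e in *. split_Rabs_max. }
    destruct HW as [W [HW [Wf HWg]]]. exists W. split; auto. split; auto.
    intros g Wg x Kx. destruct (Hl2 x Kx) as [U [HU Ux]]. eauto.
Qed.

(** The converse of [dual_bounded_on], by which evaluations and weighted series of evaluations are
    recognised as elements of the dual. *)
Lemma bounded_on_dual {X : Type} (op : (X -> Prop) -> Prop) (T : is_topology op)
    (phi : CX op -> R) (K : X -> Prop) (C : R) :
  linear_functional op phi -> compact op K -> 0 < C -> bounded_on op K C phi ->
  dual_Cc op phi.
Proof.
  intros Hl HK HC Hb. split; auto.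
  intros V HV. apply open_of_local; [apply generated_topology|].
  intros f Vf. destruct (HV _ Vf) as [e [He HVe]].
  assert (He' : 0 < e / (2 * C)) by (apply Rdiv_lt_0_compat; lra).
  destruct (compact_open_ball op K f _ HK He') as [W [HW [Wf HWg]]].
  exists W. split; auto. split; auto. intros g Wg. apply HVe.
  rewrite <- (linear_sub op phi g f (lin_CX op T 1 (-1) g f) Hl) by (intro; simpl; ring).
  eapply Rle_lt_trans.
  - apply (Hb _ _ He'). intros x Kx. simpl.
    replace (1 * val g x + -1 * val f x) with (val g x - val f x) by ring. auto.
  - replace (C * (e / (2 * C))) with (e / 2) by (field; lra). lra.
Qed.

Lemma dual_eval {X : Type} (op : (X -> Prop) -> Prop) (T : is_topology op) (x : X) :
  dual_Cc op (fun f => val f x).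
Proof.
  apply bounded_on_dual with (K := fun y => y = x) (C := 1); auto.
  - intros f g h a b H. apply H.
  - apply compact_singleton.
  - lra.
  - intros h s Hs H. rewrite Rmult_1_l. auto.
Qed.

(** * The variation of a functional and bounded convergence *)

Definition nonneg {X : Type} {op : (X -> Prop) -> Prop} (f : CX op) : Prop :=
  forall x, 0 <= val f x.

(** On nonnegative [f], [p f] plays the role of the integral of [f] against the total variation of
    the measure representing [phi]. *)
Record variation {X : Type} (op : (X -> Prop) -> Prop) (K : X -> Prop) (C : R)
    (phi p : CX op -> R) : Prop := {
  variation_ge : forall f g, (forall x, Rabs (val g x) <= val f x) -> phi g <= p f;
  variation_mono : forall f g, nonneg f -> (forall x, val f x <= val g x) -> p f <= p g;
  variation_add : forall f g h, nonneg f -> nonneg g ->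
    (forall x, val h x = val f x + val g x) -> p h = p f + p g;
  variation_le : forall f s, nonneg f -> 0 < s -> (forall x, K x -> val f x <= s) -> p f <= C * s
}.

(** For nonnegative [f], [p f] is the supremum of [phi g] over [|g| <= f]. The bound on [K] makes it
    finite, and Riesz decomposition gives additivity. *)
Lemma variation_exists {X : Type} (op : (X -> Prop) -> Prop) (T : is_topology op)
    (K : X -> Prop) (C : R) (phi : CX op -> R) :
  compact op K -> 0 < C -> linear_functional op phi -> bounded_on op K C phi ->
  exists p, variation op K C phi p.
Proof.
  intros HK HC Hl Hb.
  set (E := fun (f : CX op) r =>
    exists g : CX op, (forall x, Rabs (val g x) <= val f x) /\ r = phi g).
  assert (HE : forall f s, 0 < s -> (forall x, K x -> val f x <= s) -> is_upper_bound (E f) (C * s)).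
  { intros f s Hs Hf r [g [Hg ->]]. eapply Rle_trans; [apply Rle_abs|].
    apply Hb; auto. intros x Kx. eapply Rle_trans; [apply Hg|auto]. }
  destruct (functional_choice (fun f r => nonneg f -> is_lub (E f) r)) as [p Hp].
  (* If [f] takes a negative value, no [g] satisfies [|g| <= f], and [0] is an arbitrary default. *)
  { intro f. destruct (classic (nonneg f)) as [Hf|Hf]; [|exists 0; tauto].
    destruct (CX_bounded op K f HK) as [M [HM0 HM]].
    destruct (completeness (E f)) as [m Hm]; [| |exists m; auto].
    - exists (C * (M + 1)). apply HE; [lra|]. intros x Kx.
      specialize (HM x Kx). pose proof (Rle_abs (val f x)). lra.
    - exists (phi (const_CX op T 0)), (const_CX op T 0). split; auto.
      intro x. simpl. rewrite Rabs_R0. apply Hf. }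
  assert (Hge : forall f g, (forall x, Rabs (val g x) <= val f x) -> phi g <= p f).
  { intros f g Hg. apply Hp.
    - intro x. specialize (Hg x). pose proof (Rabs_pos (val g x)). lra.
    - exists g. auto. }
  exists p. split; auto.
  - intros f g Hf Hfg. apply (Hp f Hf). intros r [u [Hu ->]]. apply Hge.
    intro x. specialize (Hu x). specialize (Hfg x). lra.
  - intros f g h Hf Hg Hh. apply Rle_antisym.
    + apply Hp.
      { intro x. rewrite Hh. specialize (Hf x). specialize (Hg x). lra. }
      (* Riesz decomposition: truncating at height [f] leaves a remainder dominated by [g]. *)
      intros r [u [Hu ->]].
      set (u1 := clamp_CX op T u f). set (u2 := lin_CX op T 1 (-1) u u1).
      rewrite (linear_add op phi u1 u2 u Hl) by (intro; simpl; ring).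
      apply Rplus_le_compat; apply Hge; intro x; simpl;
        specialize (Hf x); specialize (Hg x); specialize (Hu x); rewrite Hh in Hu;
        split_Rabs_max.
    (* For the reverse inequality, take the supremum over [v] with [u] fixed, then the supremum over
       [u]. *)
    + assert (H1 : forall u v, (forall x, Rabs (val u x) <= val f x) ->
                (forall x, Rabs (val v x) <= val g x) -> phi u + phi v <= p h).
      { intros u v Hu Hv. rewrite <- (linear_add op phi u v (lin_CX op T 1 1 u v) Hl)
          by (intro; simpl; ring).
        apply Hge. intro x. rewrite Hh. simpl. rewrite !Rmult_1_l.
        eapply Rle_trans; [apply Rabs_triang|]. specialize (Hu x). specialize (Hv x). lra. }
      assert (H2 : forall u, (forall x, Rabs (val u x) <= val f x) -> p g <= p h - phi u).
      { intros u Hu. apply (Hp g Hg). intros r [v [Hv ->]]. specialize (H1 u v Hu Hv). lra. }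
      assert (H3 : p f <= p h - p g).
      { apply (Hp f Hf). intros r [u [Hu ->]]. specialize (H2 u Hu). lra. }
      lra.
  - intros f s Hf Hs Hfs. apply (Hp f Hf). apply HE; auto.
Qed.

(** Closing the tail under maxima allows the maximum of two successive near-maximisers to be
    compared with the earlier one. *)
Inductive max_tail {X : Type} (op : (X -> Prop) -> Prop) (T : is_topology op)
    (h : nat -> CX op) (n : nat) : CX op -> Prop :=
| max_tail_one k : (n <= k)%nat -> max_tail op T h n (h k)
| max_tail_max f g : max_tail op T h n f -> max_tail op T h n g ->
    max_tail op T h n (max_CX op T f g).

Lemma max_tail_weaken {X : Type} (op : (X -> Prop) -> Prop) (T : is_topology op)
    (h : nat -> CX op) (n m : nat) (f : CX op) :
  (m <= n)%nat -> max_tail op T h n f -> max_tail op T h m f.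
Proof.
  intros Hmn H. induction H.
  - apply max_tail_one. lia.
  - apply max_tail_max; auto.
Qed.

Lemma max_tail_ge {X : Type} (op : (X -> Prop) -> Prop) (T : is_topology op)
    (h : nat -> CX op) (n : nat) (f : CX op) (x : X) (c : R) :
  (forall k, (n <= k)%nat -> c <= val (h k) x) -> max_tail op T h n f -> c <= val f x.
Proof.
  intros Hc H. induction H; auto. simpl. eapply Rle_trans; [|apply Rmax_l]. auto.
Qed.

Lemma max_tail_le {X : Type} (op : (X -> Prop) -> Prop) (T : is_topology op)
    (h : nat -> CX op) (n : nat) (f : CX op) (x : X) (c : R) :
  (forall k, (n <= k)%nat -> val (h k) x <= c) -> max_tail op T h n f -> val f x <= c.
Proof.
  intros Hc H. induction H; auto. simpl. apply Rmax_lub; auto.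
Qed.

(** The sets where [w n < s] grow with [n], so the largest index in a finite subcover works. *)
Lemma Dini {X : Type} (op : (X -> Prop) -> Prop) (K : X -> Prop) (w : nat -> CX op) (s : R) :
  compact op K -> (forall n x, val (w (S n)) x <= val (w n) x) ->
  (forall x, K x -> exists n, val (w n) x < s) ->
  exists n, forall x, K x -> val (w n) x < s.
Proof.
  intros HK Hdec Hlim.
  assert (Hdec' : forall n m x, (n <= m)%nat -> val (w m) x <= val (w n) x).
  { intros n m x Hnm. induction Hnm; [lra|]. specialize (Hdec m x). lra. }
  destruct (HK (fun U => exists n, U = (fun x => val (w n) x < s))) as [l [Hl1 Hl2]].
  - intros U [n ->]. apply (proj2_sig (w n) (fun y => y < s)).
    intros y Hy. exists (s - y). split; [lra|]. intros z Hz. split_Rabs_max.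
  - intros x Kx. destruct (Hlim x Kx) as [n Hn]. eexists. split; [exists n; reflexivity|auto].
  - assert (Hn : exists n, forall U, In U l -> forall x, U x -> val (w n) x < s).
    { clear Hl2. induction l as [|U l IH].
      - exists 0%nat. intros U [].
      - destruct IH as [n Hn]; [intros; apply Hl1; simpl; auto|].
        destruct (Hl1 U) as [m Hm]; [simpl; auto|].
        exists (max n m). intros V [<-|HV] x Vx.
        + rewrite Hm in Vx. eapply Rle_lt_trans; [apply (Hdec' m)|auto]; lia.
        + eapply Rle_lt_trans; [apply (Hdec' n); lia|]. eapply Hn; eauto. }
    destruct Hn as [n Hn]. exists n. intros x Kx. destruct (Hl2 x Kx) as [U [? ?]]. eauto.
Qed.

(* Luxemburg's argument: [u n] almost maximises [p] over finite maxima of the tail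
   from [n] on, so the minima [w n] of [u 0, ..., u n] lose little variation, while
   they decrease to [0] and hence, by Dini, uniformly. *)
Lemma variation_bounded_convergence {X : Type} (op : (X -> Prop) -> Prop) (T : is_topology op)
    (K : X -> Prop) (C M eps : R) (phi p : CX op -> R) (h : nat -> CX op) :
  compact op K -> 0 < C -> 0 < eps -> variation op K C phi p ->
  (forall n, nonneg (h n)) -> (forall n x, K x -> val (h n) x <= M) ->
  (forall x eta, K x -> 0 < eta -> exists n, forall k, (n <= k)%nat -> val (h k) x <= eta) ->
  exists n, p (h n) < eps.
Proof.
  intros HK HC He Hp Hpos HM Hlim. apply NNPP. intro Hno.
  assert (Hbig : forall n, eps <= p (h n)).
  { intro n. apply Rnot_lt_le. intro. apply Hno. eauto. }
  clear Hno.
  assert (Dpos : forall n f, max_tail op T h n f -> nonneg f).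
  { intros n f Hf x. eapply max_tail_ge; [|exact Hf]. intros. apply Hpos. }
  (* The tolerances sum to [2 * e 0 = eps / 2]. *)
  set (e := fun n => eps / 4 * (/ 2) ^ n).
  assert (He_pos : forall n, 0 < e n).
  { intro n. unfold e. apply Rmult_lt_0_compat; [lra|]. apply pow_lt. lra. }
  assert (He_S : forall n, e (S n) = e n / 2).
  { intro n. unfold e. simpl. field. }
  destruct (functional_choice (fun n u => max_tail op T h n u /\
      forall f, max_tail op T h n f -> p f <= p u + e n)) as [u Hu].
  { intro n.
    destruct (completeness (fun r => exists f, max_tail op T h n f /\ r = p f)) as [m [Hm1 Hm2]].
    - exists (C * (Rabs M + 1)). intros r [f [Hf ->]].
      apply (variation_le _ _ _ _ _ Hp); [eapply Dpos; eauto| |].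
      + pose proof (Rabs_pos M). lra.
      + intros x Kx. eapply max_tail_le; [|exact Hf]. intros k _.
        specialize (HM k x Kx). pose proof (Rle_abs M). lra.
    - exists (p (h n)), (h n). split; auto. constructor. lia.
    (* If no element came within [e n] of the supremum [m], then [m - e n] would be a smaller upper
       bound. *)
    - apply NNPP. intro Hno.
      assert (Hub : m <= m - e n).
      { apply Hm2. intros r [f [Hf ->]]. apply Rnot_lt_le. intro Hlt. apply Hno.
        exists f. split; auto. intros g Hg.
        specialize (Hm1 (p g) (ex_intro _ g (conj Hg eq_refl))). lra. }
      specialize (He_pos n). lra. }
  set (w := fix w n := match n with
            | O => u O
            | S n => min_CX op T (w n) (u (S n)) end).
  assert (Hwu : forall n x, val (w n) x <= val (u n) x).
  { intros [|n] x; simpl; [lra|]. apply Rmin_r. }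
  assert (Hwpos : forall n, nonneg (w n)).
  { intro n. induction n; intro x; simpl.
    - apply (Dpos 0%nat). apply Hu.
    - apply Rmin_glb; [apply IHn|]. apply (Dpos (S n)). apply Hu. }
  assert (Hupos : forall n, nonneg (u n)) by (intro n; apply (Dpos n), Hu).
  (* The loss up to [n] is the sum of [e j] over [j < n], which equals [2 * e 0 - 2 * e n]. *)
  assert (Hinv : forall n, p (u n) - 2 * e 0%nat + 2 * e n <= p (w n)).
  { induction n as [|n IH]; [simpl; lra|].
    pose (mx := max_CX op T (w n) (u (S n))).
    pose (sm := lin_CX op T 1 1 (w n) (u (S n))).
    assert (H1 : p sm = p (w n) + p (u (S n))).
    { apply (variation_add _ _ _ _ _ Hp); auto. intro; simpl; ring. }
    (* Minimum plus maximum is the sum; the maximum lies below an element of the tail from [n] on,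
       whose variation exceeds [p (u n)] by at most [e n]. *)
    assert (H2 : p sm = p (w (S n)) + p mx).
    { apply (variation_add _ _ _ _ _ Hp); auto.
      - intro x. simpl. eapply Rle_trans; [|apply Rmax_l]. apply Hwpos.
      - intro x. simpl. split_Rabs_max. }
    assert (H3 : p mx <= p (u n) + e n).
    { apply Rle_trans with (p (max_CX op T (u n) (u (S n)))).
      - apply (variation_mono _ _ _ _ _ Hp).
        + intro x. simpl. eapply Rle_trans; [|apply Rmax_l]. apply Hwpos.
        + intro x. simpl. apply Rle_max_compat_r. apply Hwu.
      - apply Hu. apply max_tail_max; [apply Hu|].
        apply max_tail_weaken with (S n); [lia|]. apply Hu. }
    rewrite He_S. lra. }
  assert (He0 : e 0%nat = eps / 4) by (unfold e; simpl; field).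
  destruct (Dini op K w (eps / (4 * C)) HK) as [n Hn].
  - intros n x. simpl. apply Rmin_l.
  - intros x Kx. assert (Hs : 0 < eps / (8 * C)) by (apply Rdiv_lt_0_compat; lra).
    destruct (Hlim x _ Kx Hs) as [n Hn]. exists n.
    apply Rle_lt_trans with (eps / (8 * C)).
    + eapply Rle_trans; [apply Hwu|]. eapply max_tail_le; [exact Hn|]. apply Hu.
    + apply Rmult_lt_compat_l; auto. apply Rinv_lt_contravar; nra.
  (* Now [p (w n) <= eps / 4], and a total loss below [eps / 2] contradicts [eps <= p (h n)]. *)
  - assert (H1 : p (w n) <= C * (eps / (4 * C))).
    { apply (variation_le _ _ _ _ _ Hp); auto.
      - apply Rdiv_lt_0_compat; lra.
      - intros x Kx. left. auto. }
    replace (C * (eps / (4 * C))) with (eps / 4) in H1 by (field; lra).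
    destruct (Hu n) as [_ Hun].
    specialize (Hun (h n) (max_tail_one _ _ _ _ n (le_n n))).
    specialize (Hinv n). specialize (Hbig n). specialize (He_pos n). lra.
Qed.

Lemma countable_exhaustion {X : Type} (c : X -> nat) (n : nat) :
  (forall x y, c x = c y -> x = y) -> exists l, forall x, (c x <= n)%nat -> In x l.
Proof.
  intro Hc.
  assert (H1 : forall k, exists l, forall x, c x = k -> In x l).
  { intro k. destruct (classic (exists x, c x = k)) as [[x Hx]|Hn].
    - exists [x]. intros y Hy. left. apply Hc. congruence.
    - exists nil. intros x Hx. exfalso. eauto. }
  induction n as [|n [l Hl]].
  - destruct (H1 0%nat) as [l Hl]. exists l. intros x Hx. apply Hl. lia.
  - destruct (H1 (S n)) as [m Hm]. exists (l ++ m). intros x Hx. apply in_or_app.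
    destruct (Nat.eq_dec (c x) (S n)); [right; auto | left; apply Hl; lia].
Qed.

(** Otherwise there are [h n] bounded by [M] on [K], at most [1 / (n + 1)] at the points of code up
    to [n], with [|phi (h n)| >= eps]. Every point is eventually among these, so [|h n|] tends to
    [0] pointwise, against bounded convergence for the variation. *)
Lemma dual_pointwise_continuous {X : Type} (op : (X -> Prop) -> Prop) (T : is_topology op)
    (phi : CX op -> R) :
  countable_type X -> dual_Cc op phi ->
  exists K, compact op K /\ forall M eps, 0 < eps ->
    exists (F : list X) delta, 0 < delta /\ forall h : CX op,
      (forall x, K x -> Rabs (val h x) <= M) -> (forall x, In x F -> Rabs (val h x) <= delta) ->
      Rabs (phi h) < eps.
Proof.
  intros [c Hc] Hphi.
  destruct (dual_bounded_on op T phi Hphi) as [K [C [HK [HC Hb]]]].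
  exists K. split; auto. intros M eps He. apply NNPP. intro Hno.
  destruct (variation_exists op T K C phi HK HC (proj1 Hphi) Hb) as [p Hp].
  destruct (functional_choice (fun n (h : CX op) => (forall x, K x -> Rabs (val h x) <= M) /\
    (forall x, (c x <= n)%nat -> Rabs (val h x) <= / (INR n + 1)) /\ eps <= Rabs (phi h))) as [h Hh].
  { intro n. apply NNPP. intro Hn. apply Hno.
    destruct (countable_exhaustion c n Hc) as [l Hl].
    exists l, (/ (INR n + 1)). split; [apply Rinv_0_lt_compat; pose proof (pos_INR n); lra|].
    intros h H1 H2. apply Rnot_le_lt. intro H3. apply Hn. exists h. auto. }
  destruct (variation_bounded_convergence op T K C M eps phi p (fun n => abs_CX op T (h n)))
    as [n Hn]; auto.
  - intros n x. simpl. apply Rabs_pos.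
  - intros n x Kx. simpl. apply Hh. exact Kx.
  - intros x eta Kx Heta. destruct (INR_unbounded (/ eta)) as [n Hn].
    exists (max n (c x)). intros k Hk. simpl.
    destruct (Hh k) as [_ [H _]]. eapply Rle_trans; [apply H; lia|].
    rewrite <- (Rinv_inv eta). apply Rinv_le_contravar; [apply Rinv_0_lt_compat; auto|].
    assert (INR n <= INR k) by (apply le_INR; lia). lra.
  - destruct (Hh n) as [_ [_ H]].
    assert (H1 : phi (h n) <= p (abs_CX op T (h n))).
    { apply (variation_ge _ _ _ _ _ Hp). intro x. simpl. lra. }
    assert (H2 : - phi (h n) <= p (abs_CX op T (h n))).
    { rewrite <- (linear_opp op phi (h n) (lin_CX op T (-1) 0 (h n) (h n)) (proj1 Hphi))
        by (intro; simpl; ring).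
      apply (variation_ge _ _ _ _ _ Hp). intro x. simpl.
      replace (-1 * val (h n) x + 0 * val (h n) x) with (- val (h n) x) by ring.
      rewrite Rabs_Ropp. lra. }
    split_Rabs_max.
Qed.

(** * Weakly bounded families *)

Definition weakly_bounded {X : Type} (op : (X -> Prop) -> Prop) (H : CX op -> Prop) : Prop :=
  forall phi, dual_Cc op phi -> exists M, forall f, H f -> Rabs (phi f) <= M.

(** The functional is the atomic measure with mass [a n] at [x n]; its total mass is at most [2],
    the sum of the geometric series. *)
Lemma dual_series {X : Type} (op : (X -> Prop) -> Prop) (T : is_topology op) (K : X -> Prop)
    (a : nat -> R) (x : nat -> X) :
  compact op K -> (forall n, K (x n)) -> (forall n, 0 <= a n <= (/ 2) ^ n) ->
  (forall f : CX op, ex_series (fun n => a n * val f (x n))) /\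
  dual_Cc op (fun f => Series (fun n => a n * val f (x n))).
Proof.
  intros HK Kx Ha.
  assert (Hgeo : is_series (fun n => (/ 2) ^ n) 2).
  { assert (Hg : is_series (fun n => (/ 2) ^ n) (/ (1 - / 2))).
    { apply is_series_geom. rewrite Rabs_pos_eq; lra. }
    replace (/ (1 - / 2)) with 2 in Hg by field. exact Hg. }
  assert (Hle : forall (f : CX op) s, (forall y, K y -> Rabs (val f y) <= s) -> forall n,
            Rabs (a n * val f (x n)) <= s * (/ 2) ^ n).
  { intros f s Hf n. rewrite Rabs_mult, (Rabs_pos_eq (a n)) by apply Ha.
    specialize (Hf _ (Kx n)). specialize (Ha n). pose proof (Rabs_pos (val f (x n))). nra. }
  assert (Hdom : forall s, is_series (fun n => s * (/ 2) ^ n) (s * 2)).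
  { intro s. apply (is_series_scal s _ _ Hgeo). }
  assert (Habs : forall f : CX op, ex_series (fun n => Rabs (a n * val f (x n)))).
  { intro f. destruct (CX_bounded op K f HK) as [M [_ HM]].
    apply (ex_series_le (fun n => Rabs (a n * val f (x n))) (fun n => M * (/ 2) ^ n)).
    - intro n. change norm with Rabs. rewrite Rabs_Rabsolu. apply Hle, HM.
    - eexists. apply Hdom. }
  assert (Hex : forall f : CX op, ex_series (fun n => a n * val f (x n))).
  { intro f. apply ex_series_Rabs, Habs. }
  split; auto.
  apply bounded_on_dual with (K := K) (C := 2); auto.
  - intros f g h b c Hh.
    rewrite <- !Series_scal_l, <- Series_plus.
    + apply Series_ext. intro n. rewrite Hh. ring.
    + apply (ex_series_scal b (fun n => a n * val f (x n))). apply Hex.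
    + apply (ex_series_scal c (fun n => a n * val g (x n))). apply Hex.
  - lra.
  - intros h s Hs Hh. eapply Rle_trans; [apply Series_Rabs, Habs|].
    rewrite Rmult_comm, <- (is_series_unique _ _ (Hdom s)). apply Series_le.
    + intro n. split; [apply Rabs_pos|]. apply Hle, Hh.
    + eexists. apply Hdom.
Qed.

(* Gliding hump: [f k] is large at [x k] compared with the contribution of the earlier
   points, and the later weights are small compared with the size of [f k] on [K]. *)
Lemma weakly_bounded_uniform {X : Type} (op : (X -> Prop) -> Prop) (T : is_topology op)
    (H : CX op -> Prop) (K : X -> Prop) :
  weakly_bounded op H -> compact op K ->
  exists M, forall f x, H f -> K x -> Rabs (val f x) <= M.
Proof.
  intros HH HK. apply NNPP. intro Hno.
  destruct (functional_choice (fun (M : R) (fx : CX op * X) =>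
     H (fst fx) /\ K (snd fx) /\ M < Rabs (val (fst fx) (snd fx)))) as [pick Hpick].
  { intro M. apply NNPP. intro Hn. apply Hno. exists M. intros f x Hf Kx.
    apply Rnot_lt_le. intro. apply Hn. exists (f, x). auto. }
  destruct (functional_choice (fun (f : CX op) M => 0 <= M /\ forall x, K x -> Rabs (val f x) <= M))
    as [B HB].
  { intro f. apply CX_bounded. exact HK. }
  destruct (functional_choice (fun x M => forall f, H f -> Rabs (val f x) <= M)) as [b Hb].
  { intro x. apply (HH (fun f => val f x)). apply dual_eval. exact T. }
  (* From the state [(a k, s k)], where [s k] bounds the contribution of the earlier points on [H],
     the threshold makes [a k * |f k (x k)|] exceed [k + 2 + s k]. Dividing the next weight by
     [2 * (1 + B (f k))] makes the later terms for [f k] add up to at most [1]. *)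
  set (choose := fun (k : nat) (st : R * R) => pick ((INR k + 2 + snd st) / fst st)).
  set (st := fix st k := match k with
     | O => (1, 0)
     | S k => (fst (st k) / (2 * (1 + B (fst (choose k (st k))))),
               snd (st k) + fst (st k) * b (snd (choose k (st k))))
     end).
  set (a := fun k => fst (st k)). set (s := fun k => snd (st k)).
  set (f := fun k => fst (choose k (st k))). set (x := fun k => snd (choose k (st k))).
  assert (HaS : forall k, a (S k) = a k / (2 * (1 + B (f k)))) by reflexivity.
  assert (HsS : forall k, s (S k) = s k + a k * b (x k)) by reflexivity.
  assert (HB0 : forall k, 0 <= B (f k)) by (intro; apply HB).
  assert (Ha0 : forall k, 0 < a k).
  { induction k; [unfold a; simpl; lra|]. rewrite HaS. apply Rdiv_lt_0_compat; auto.
    specialize (HB0 k). lra. }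
  assert (HaB : forall k, 2 * a (S k) * (1 + B (f k)) = a k).
  { intro k. rewrite HaS. field. specialize (HB0 k). lra. }
  assert (Ha2 : forall k, 2 * a (S k) <= a k).
  { intro k. specialize (HaB k). specialize (HB0 k). specialize (Ha0 (S k)). nra. }
  assert (Hapow : forall k, 0 <= a k <= (/ 2) ^ k).
  { induction k; [unfold a; simpl; lra|]. specialize (Ha2 k). specialize (Ha0 (S k)).
    simpl. lra. }
  assert (HfH : forall k, H (f k)) by (intro; apply Hpick).
  assert (HxK : forall k, K (x k)) by (intro; apply Hpick).
  assert (Hhump : forall k, INR k + 2 + s k < a k * Rabs (val (f k) (x k))).
  { intro k. destruct (Hpick ((INR k + 2 + s k) / a k)) as [_ [_ Hk]].
    fold (a k) in Hk. apply Rmult_lt_compat_l with (r := a k) in Hk; [|auto].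
    replace (a k * ((INR k + 2 + s k) / a k)) with (INR k + 2 + s k) in Hk
      by (field; specialize (Ha0 k); lra).
    exact Hk. }
  destruct (dual_series op T K a x HK HxK Hapow) as [Hex Hdual].
  set (P := fun (g : CX op) n => sum_n (fun j => a j * val g (x j)) n : R).
  assert (HP0 : forall g, P g 0%nat = a 0%nat * val g (x 0%nat)) by (intro; apply sum_O).
  assert (HPS : forall g n, P g (S n) = P g n + a (S n) * val g (x (S n)))
    by (intros g n; apply (sum_Sn (fun j => a j * val g (x j)))).
  assert (Haabs : forall k r, Rabs (a k * r) = a k * Rabs r).
  { intros k r. rewrite Rabs_mult, (Rabs_pos_eq (a k)); [reflexivity | left; auto]. }
  assert (Hrev : forall q z, Rabs z - Rabs q <= Rabs (q + z)) by (intros; split_Rabs_max).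
  assert (Hs0 : s 0%nat = 0) by reflexivity.
  assert (HPs : forall g n, H g -> Rabs (P g n) <= s (S n)).
  { intros g n Hg.
    assert (Hj : forall j, a j * Rabs (val g (x j)) <= a j * b (x j)).
    { intro j. apply Rmult_le_compat_l; [left; auto|]. apply Hb, Hg. }
    induction n as [|n IH].
    - rewrite HP0, HsS, Haabs, Hs0. specialize (Hj 0%nat). lra.
    - rewrite HPS, HsS. eapply Rle_trans; [apply Rabs_triang|].
      rewrite Haabs. specialize (Hj (S n)). lra. }
  (* The reserve [2 * a (S n) * B (f k)] pays for all terms after [n], since the weights at least
     halve at each step; this keeps the induction going. *)
  assert (Hlow : forall k n, (k <= n)%nat ->
            INR k + 1 + 2 * a (S n) * B (f k) <= Rabs (P (f k) n)).
  { intros k n Hkn. induction Hkn as [|n Hkn IH].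
    - assert (H1 : Rabs (P (f k) k) >= a k * Rabs (val (f k) (x k)) - s k).
      { rewrite <- Haabs. destruct k as [|k].
        - rewrite HP0, Hs0. lra.
        - rewrite HPS. pose proof (HPs (f (S k)) k (HfH (S k))).
          pose proof (Hrev (P (f (S k)) k) (a (S k) * val (f (S k)) (x (S k)))). lra. }
      specialize (Hhump k). specialize (HaB k). specialize (HB0 k). specialize (Ha0 (S k)).
      assert (a k <= 1).
      { destruct (Hapow k) as [_ H2]. eapply Rle_trans; [exact H2|].
        rewrite pow_inv. rewrite <- Rinv_1. apply Rinv_le_contravar; [lra|].
        apply pow_R1_Rle. lra. }
      nra.
    - rewrite HPS.
      pose proof (Hrev (a (S n) * val (f k) (x (S n))) (P (f k) n)) as H1.
      rewrite Haabs, (Rplus_comm (a (S n) * _)) in H1.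
      assert (Rabs (val (f k) (x (S n))) <= B (f k)) by (apply HB, HxK).
      specialize (HB0 k). specialize (Ha0 (S n)). specialize (Ha2 (S n)). nra. }
  (* The series functional is bounded by [M] on [H], but its absolute value at [f k] is at least
     [k]. *)
  destruct (HH _ Hdual) as [M HM].
  destruct (INR_unbounded M) as [k Hk].
  specialize (HM (f k) (HfH k)). simpl in HM.
  assert (Hl : is_lim_seq (fun n => Rabs (P (f k) n)) (Rabs (Series (fun n => a n * val (f k) (x n))))).
  { apply (is_lim_seq_abs _ (Finite _)). apply (Series_correct _ (Hex (f k))). }
  assert (Hle : Rbar_le (INR k) (Rabs (Series (fun n => a n * val (f k) (x n))))).
  { apply (is_lim_seq_le_loc (fun _ => INR k) (fun n => Rabs (P (f k) n))); auto using is_lim_seq_const.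
    exists k. intros n Hn. specialize (Hlow k n Hn). specialize (HB0 k). specialize (Ha0 (S n)). nra. }
  simpl in Hle. lra.
Qed.

(** * Outer approximation of compact sets *)

(** The union of a finite subcover of [K] is open, hence contains all but finitely many [x n]; one
    further set is added for each remaining point. *)
Lemma compact_converging_sequence {X : Type} (op : (X -> Prop) -> Prop) (T : is_topology op)
    (K : X -> Prop) (x : nat -> X) :
  compact op K ->
  (forall U, op U -> (forall y, K y -> U y) -> exists n, forall k, (n <= k)%nat -> U (x k)) ->
  compact op (fun y => K y \/ exists n, y = x n).
Proof.
  intros HK Hx F HF Hc.
  destruct (HK F HF) as [l [Hl1 Hl2]]; [intros; apply Hc; auto|].
  destruct (Hx (fun y => exists U, In U l /\ U y)) as [n Hn]; auto.
  { apply (proj2 (proj2 T) (fun U => In U l)). auto. }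
  assert (Hm : exists m, (forall U, In U m -> F U) /\
            forall k, (k < n)%nat -> exists U, In U m /\ U (x k)).
  { clear Hn. induction n as [|n [m [Hm1 Hm2]]].
    - exists nil. split; [intros U [] | intros; lia].
    - destruct (Hc (x n)) as [U [FU Ux]]; [eauto|].
      exists (U :: m). split; [intros V [<-|HV]; auto|].
      intros k Hk. destruct (Nat.eq_dec k n) as [->|Hne].
      + exists U. simpl; auto.
      + destruct (Hm2 k) as [V [? ?]]; [lia|]. exists V. simpl; auto. }
  destruct Hm as [m [Hm1 Hm2]]. exists (l ++ m). split.
  - intros U HU. apply in_app_or in HU. destruct HU; auto.
  - assert (Hin : forall y, (exists U, In U l /\ U y) \/ (exists U, In U m /\ U y) ->
              exists U, In U (l ++ m) /\ U y).
    { intros y [[U [? ?]]|[U [? ?]]]; exists U; split; auto; apply in_or_app; auto. }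
    intros y [Ky|[k ->]]; apply Hin; auto.
    destruct (Nat.lt_ge_cases k n); auto.
Qed.

(** * Codings and enumerations of countable types *)

Lemma countable_nat : countable_type nat.
Proof. exists (fun n => n). auto. Qed.

Lemma countable_prod (A B : Type) :
  countable_type A -> countable_type B -> countable_type (A * B).
Proof.
  intros [f Hf] [g Hg]. exists (fun p => to_nat (f (fst p), g (snd p))).
  intros [a b] [a' b'] H. apply to_nat_inj in H. simpl in H. injection H as H1 H2.
  f_equal; auto.
Qed.

Lemma countable_list (A : Type) : countable_type A -> countable_type (list A).
Proof.
  intros [f Hf].
  (* The successor keeps the codes of nonempty lists apart from the code [0] of [nil]. *)
  exists (fix code l := match l with nil => 0%nat | a :: l => S (to_nat (f a, code l)) end).
  induction x as [|a l IH]; intros [|a' l'] H; try discriminate; auto.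
  apply Nat.succ_inj, to_nat_inj in H. injection H as H1 H2. f_equal; auto.
Qed.

Lemma countable_enum (A : Type) (a0 : A) :
  countable_type A -> exists e : nat -> A, forall a, exists n, e n = a.
Proof.
  intros [c Hc].
  destruct (functional_choice (fun n a => (exists a', c a' = n) -> c a = n)) as [e He].
  { intro n. destruct (classic (exists a', c a' = n)) as [[a Ha]|Hn].
    - exists a. auto.
    - exists a0. tauto. }
  exists e. intro a. exists (c a). apply Hc. apply He. eauto.
Qed.

(** Finite intersections of finite unions of network members, given by lists of indices so that
    there are only countably many. *)
Definition cap_cup {X : Type} (N : nat -> X -> Prop) (ll : list (list nat)) (x : X) : Prop :=
  forall l, In l ll -> exists i, In i l /\ N i x.

(* Otherwise unboundedness on a decreasing sequence of outer approximations of [K] would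
   give points [x n] such that [K] together with all [x n] is compact, while the family
   is unbounded on it. *)
Lemma bounded_on_network_set {X : Type} (op : (X -> Prop) -> Prop) (T : is_topology op)
    (N : nat -> X -> Prop) (HN : k_network op (fun A => exists n, N n = A))
    (H : CX op -> Prop) (K : X -> Prop) :
  weakly_bounded op H -> compact op K ->
  exists ll (M : nat), (forall x, K x -> cap_cup N ll x) /\
    forall f x, H f -> cap_cup N ll x -> Rabs (val f x) <= INR M.
Proof.
  intros HH HK. apply NNPP. intro Hno.
  destruct (countable_enum (list nat) nil (countable_list _ countable_nat)) as [d Hd].
  (* The list gathers those among the first [n] unions that contain [K]; their intersection is the
     [n]-th outer approximation. *)
  assert (Happ : forall n, exists ll, (forall x, K x -> cap_cup N ll x) /\
    forall k, (k < n)%nat -> (forall x, K x -> cap_cup N [d k] x) -> In (d k) ll).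
  { induction n as [|n [ll [Hll1 Hll2]]].
    - exists nil. split; [intros x _ l []|intros; lia].
    - destruct (classic (forall x, K x -> cap_cup N [d n] x)) as [Hn|Hn].
      + exists (d n :: ll). split.
        * intros x Kx l [<-|Hl]; [apply (Hn x Kx); simpl; auto|apply (Hll1 x Kx l Hl)].
        * intros k Hk Hkk. destruct (Nat.eq_dec k n) as [->|]; [simpl; auto|].
          right. apply Hll2; auto. lia.
      + exists ll. split; auto. intros k Hk Hkk.
        destruct (Nat.eq_dec k n) as [->|]; [contradiction|]. apply Hll2; auto. lia. }
  destruct (functional_choice (fun n x => (exists f, H f /\ INR n < Rabs (val f x)) /\
     forall k, (k < n)%nat -> (forall x, K x -> cap_cup N [d k] x) -> cap_cup N [d k] x))
    as [x Hx].
  { intro n. destruct (Happ n) as [ll [Hll1 Hll2]]. apply NNPP. intro Hn. apply Hno.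
    exists ll, n. split; auto. intros f x Hf Hx. apply Rnot_lt_le. intro Hlt. apply Hn.
    exists x. split; [eauto|]. intros k Hk Hkk l [<-|[]]. apply Hx. auto. }
  assert (HL : compact op (fun y => K y \/ exists n, y = x n)).
  { apply compact_converging_sequence; auto. intros U HU KU.
    destruct (HN K U HK HU KU) as [l [Hl1 [Hl2 Hl3]]].
    assert (Hi : exists l', forall A, In A l <-> exists i, In i l' /\ N i = A).
    { clear Hl2 Hl3. induction l as [|A l IH].
      - exists nil. intro A. split; [intros []|intros [i [[] _]]].
      - destruct IH as [l' Hl']; [intros; apply Hl1; simpl; auto|].
        destruct (Hl1 A) as [i Hi]; [simpl; auto|].
        exists (i :: l'). intro B. split.
        + intros [<-|HB]; [exists i; simpl; auto|].
          apply Hl' in HB. destruct HB as [j [? ?]]. exists j. simpl; auto.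
        + intros [j [[<-|Hj] Hj']]; [left; congruence|]. right. apply Hl'. eauto. }
    destruct Hi as [l' Hl']. destruct (Hd l') as [k Hk].
    (* From index [k + 1] on, [x n] was chosen inside the union coded by [d k], hence inside [U]. *)
    exists (S k). intros n Hn. destruct (Hx n) as [_ Hxn].
    assert (Hin : cap_cup N [d k] (x n)).
    { apply Hxn; [lia|]. intros y Ky m [<-|[]].
      destruct (Hl2 y Ky) as [A [HA Ay]]. apply Hl' in HA. destruct HA as [i [? <-]].
      exists i. rewrite Hk. auto. }
    destruct (Hin (d k)) as [i [Hi Ni]]; [simpl; auto|].
    apply (Hl3 (N i)); auto. apply Hl'. exists i. rewrite <- Hk. auto. }
  destruct (weakly_bounded_uniform op T H _ HH HL) as [M HM].
  destruct (INR_unbounded M) as [n Hn].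
  destruct (Hx n) as [[f [Hf Hlt]] _].
  specialize (HM f (x n) Hf (or_intror (ex_intro _ n eq_refl))). lra.
Qed.

(** * The weak topology *)

Lemma weak_open_ball {X : Type} (op : (X -> Prop) -> Prop) (phi : CX op -> R) (c r : R) :
  dual_Cc op phi -> weak_topology_Cc op (fun f => Rabs (phi f - c) < r).
Proof.
  intro Hphi. apply generated_subbasic. exists phi, (fun y => Rabs (y - c) < r).
  split; [|split]; auto using R_open_ball. tauto.
Qed.

Lemma weak_compact_bounded {X : Type} (op : (X -> Prop) -> Prop) (H : CX op -> Prop) :
  compact (weak_topology_Cc op) H -> weakly_bounded op H.
Proof.
  intros HH phi Hphi.
  destruct (compact_bounded (weak_topology_Cc op) H phi HH) as [M [_ HM]]; [|eauto].
  intro n. erewrite set_ext; [apply (weak_open_ball op phi 0 (INR n) Hphi)|].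
  intro f. simpl. rewrite Rminus_0_r. tauto.
Qed.

(** Evaluations separate points, and the closure of a half-radius ball for a functional stays within
    the full ball. *)
Lemma weak_regular {X : Type} (op : (X -> Prop) -> Prop) (T : is_topology op) :
  regular_space (weak_topology_Cc op).
Proof.
  split.
  - intros f g Hfg.
    assert (Hx : exists x, val f x <> val g x).
    { apply NNPP. intro Hn. apply Hfg. destruct f as [f Hf], g as [g Hg].
      assert (E : f = g).
      { apply functional_extensionality. intro x. apply NNPP. intro. apply Hn. eauto. }
      subst g. f_equal. apply proof_irrelevance. }
    destruct Hx as [x Hx].
    exists (fun h => Rabs (val h x - val f x) < Rabs (val g x - val f x)).
    split; [apply (weak_open_ball op (fun h => val h x)), dual_eval, T|].
    rewrite Rminus_diag, Rabs_R0. split; [|lra]. apply Rabs_pos_lt. lra.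
  - intros f U HU Uf. destruct (HU f Uf) as [l [Hl1 [Hl2 Hl3]]].
    assert (HV : exists V, weak_topology_Cc op V /\ V f /\ forall y,
      (forall W, weak_topology_Cc op W -> W y -> exists z, W z /\ V z) -> forall A, In A l -> A y).
    { clear Hl3. induction l as [|A l IH].
      - exists (fun _ => True). split; [apply generated_topology|]. split; auto. intros y _ A [].
      - destruct IH as [V [HV [Vf HVl]]];
          [intros; apply Hl1; simpl; auto | intros; apply Hl2; simpl; auto|].
        destruct (Hl1 A) as [phi [O [Hphi [HO HA]]]]; [simpl; auto|].
        destruct (HO (phi f)) as [e [He HOe]]; [apply HA, Hl2; simpl; auto|].
        exists (fun g => V g /\ Rabs (phi g - phi f) < e / 2). split; [|split].
        + apply generated_topology; auto. apply (weak_open_ball op phi (phi f) (e / 2) Hphi).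
        + split; auto. rewrite Rminus_diag, Rabs_R0. lra.
        + intros y Hy B [<-|HB].
          * destruct (Hy (fun g => Rabs (phi g - phi y) < e / 2)) as [z [Hz [_ Hz']]].
            -- apply weak_open_ball, Hphi.
            -- rewrite Rminus_diag, Rabs_R0. lra.
            -- apply HA, HOe. split_Rabs_max.
          * apply HVl; auto. intros W HW Wy.
            destruct (Hy W HW Wy) as [z [Wz [Vz _]]]. eauto. }
    destruct HV as [V [HV [Vf HVl]]]. exists V. split; auto. split; auto.
    intros y Hy. apply Hl3. exact (HVl y Hy).
Qed.

(** * The countable k-network of sets of functions *)

Definition bound_set {X : Type} (op : (X -> Prop) -> Prop) (N : nat -> X -> Prop)
    (b : list (list (list nat) * nat)) (g : CX op) : Prop :=
  forall ll M, In (ll, M) b -> forall x, cap_cup N ll x -> Rabs (val g x) <= INR M.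

(* An entry [(x, (i, j, m))] constrains [g x] to the ball of radius [1/(m+1)] around the
   rational number [(i-j)/(m+1)]. *)
Definition point_set {X : Type} (op : (X -> Prop) -> Prop)
    (q : list (X * (nat * nat * nat))) (g : CX op) : Prop :=
  forall x i j m, In (x, (i, j, m)) q ->
    Rabs (val g x - (INR i - INR j) / (INR m + 1)) < / (INR m + 1).

(** The two conditions have different tasks: the bounds will hold on a whole weakly compact set,
    while the point conditions define weakly open sets that cover it. *)
Definition weak_network {X : Type} (op : (X -> Prop) -> Prop) (N : nat -> X -> Prop)
    (t : list (list (list nat) * nat) * list (X * (nat * nat * nat))) (g : CX op) : Prop :=
  bound_set op N (fst t) g /\ point_set op (snd t) g.

Lemma point_set_open {X : Type} (op : (X -> Prop) -> Prop) (T : is_topology op)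
    (q : list (X * (nat * nat * nat))) :
  weak_topology_Cc op (point_set op q).
Proof.
  induction q as [|[x [[i j] m]] q IH].
  - rewrite (set_ext (point_set op nil) (fun _ => True)); [apply generated_topology|].
    intro g. split; auto. intros _ x i j m [].
  - rewrite (set_ext (point_set op _) (fun g => point_set op q g /\
      Rabs (val g x - (INR i - INR j) / (INR m + 1)) < / (INR m + 1))).
    + apply generated_topology; auto.
      apply (weak_open_ball op (fun g => val g x)), dual_eval, T.
    + intro g. split.
      * intro Hg. split; [intros y i' j' m' Hy|]; apply Hg; simpl; auto.
      * intros [Hg Hx] y i' j' m' [E|Hy]; [injection E as <- <- <- <-; auto | auto].
Qed.

Lemma rational_approx (r : R) (m : nat) :
  exists i j : nat, Rabs (r - (INR i - INR j) / (INR m + 1)) < / (INR m + 1).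
Proof.
  assert (Hz : exists z : Z, Rabs (r * (INR m + 1) - IZR z) < 1).
  { exists (Int_part (r * (INR m + 1))).
    destruct (base_Int_part (r * (INR m + 1))). rewrite Rabs_pos_eq; lra. }
  destruct Hz as [z Hz].
  (* These are the positive and negative parts of the integer [z]. *)
  exists (Z.to_nat z), (Z.to_nat (- z)).
  replace (INR (Z.to_nat z) - INR (Z.to_nat (- z))) with (IZR z).
  - pose proof (pos_INR m).
    replace (r - IZR z / (INR m + 1)) with ((r * (INR m + 1) - IZR z) * / (INR m + 1))
      by (field; lra).
    assert (0 < / (INR m + 1)) by (apply Rinv_0_lt_compat; lra).
    rewrite Rabs_mult, (Rabs_pos_eq (/ (INR m + 1))) by lra. nra.
  - rewrite !INR_IZR_INZ, <- minus_IZR. f_equal. lia.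
Qed.

Lemma point_set_ball {X : Type} (op : (X -> Prop) -> Prop) (f : CX op) (F : list X) (delta : R) :
  0 < delta ->
  exists q, point_set op q f /\
    forall g, point_set op q g -> forall x, In x F -> Rabs (val g x - val f x) <= delta.
Proof.
  intro Hd.
  (* With this [m], two points of one ball of radius [1 / (m + 1)] differ by at most [delta]. *)
  destruct (INR_unbounded (2 / delta)) as [m Hm].
  assert (Hm' : 2 * / (INR m + 1) <= delta).
  { assert (0 < 2 / delta) by (apply Rdiv_lt_0_compat; lra).
    apply Rmult_le_reg_r with (INR m + 1); [lra|].
    rewrite Rmult_assoc, Rinv_l by lra.
    apply Rmult_lt_compat_l with (r := delta) in Hm; [|lra].
    replace (delta * (2 / delta)) with 2 in Hm by (field; lra). lra. }
  induction F as [|x F [q [Hqf Hq]]].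
  - exists nil. split; [intros x i j k []|]. intros g _ x [].
  - destruct (rational_approx (val f x) m) as [i [j Hij]].
    exists ((x, (i, j, m)) :: q). split.
    + intros y i' j' m' [E|Hy]; [injection E as <- <- <- <-; auto | auto].
    + intros g Hg y [<-|Hy].
      * specialize (Hg x i j m (or_introl eq_refl)).
        set (c := (INR i - INR j) / (INR m + 1)) in *.
        set (d := / (INR m + 1)) in *. clearbody c d. split_Rabs_max.
      * apply Hq; auto. intros z i' j' m' Hz. apply Hg. simpl; auto.
Qed.

(** Each of the finitely many functionals defining a neighbourhood of [f] inside [U] contributes one
    bound condition, valid on all of [H], and finitely many point conditions around [f]. *)
Lemma weak_network_local {X : Type} (op : (X -> Prop) -> Prop) (T : is_topology op)
    (N : nat -> X -> Prop) (HN : k_network op (fun A => exists n, N n = A))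
    (Hcount : countable_type X) (H U : CX op -> Prop) (f : CX op) :
  weakly_bounded op H -> weak_topology_Cc op U -> H f -> U f ->
  exists t, (forall g, H g -> bound_set op N (fst t) g) /\ point_set op (snd t) f /\
    forall g, weak_network op N t g -> U g.
Proof.
  intros HH HU Hf Uf. destruct (HU f Uf) as [l [Hl1 [Hl2 Hl3]]].
  assert (Ht : exists t, (forall g, H g -> bound_set op N (fst t) g) /\ point_set op (snd t) f /\
    forall g, weak_network op N t g -> forall A, In A l -> A g).
  { clear Hl3. induction l as [|A l IH].
    - exists (nil, nil). split; [intros g _ ll M []|]. split; [intros x i j m []|].
      intros g _ A [].
    - destruct IH as [[b q] [Hb [Hq Hbq]]];
        [intros; apply Hl1; simpl; auto | intros; apply Hl2; simpl; auto|].
      destruct (Hl1 A) as [phi [V [Hphi [HV HA]]]]; [simpl; auto|].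
      destruct (HV (phi f)) as [e [He HVe]]; [apply HA, Hl2; simpl; auto|].
      destruct (dual_pointwise_continuous op T phi Hcount Hphi) as [K [HK HKphi]].
      destruct (bounded_on_network_set op T N HN H K HH HK) as [ll [M [Kll HM]]].
      (* Both [f] and [g] are bounded by [M] on an outer approximation of [K], so their difference
         is bounded by [2 * M] on [K]. *)
      destruct (HKphi (2 * INR M) e He) as [F [d [Hd HF]]].
      destruct (point_set_ball op f F d Hd) as [q' [Hq'f Hq']].
      exists ((ll, M) :: b, q' ++ q). simpl. split; [|split].
      + intros g Hg ll' M' [E|HE].
        * injection E as <- <-. intros x Hx. auto.
        * apply (Hb g Hg); auto.
      + intros x i j m Hin. apply in_app_or in Hin. destruct Hin; [apply Hq'f | apply Hq]; auto.
      + intros g [Hg1 Hg2] B [<-|HB]; simpl in Hg1, Hg2.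
        * apply HA, HVe.
          rewrite <- (linear_sub op phi g f (lin_CX op T 1 (-1) g f) (proj1 Hphi))
            by (intro; simpl; ring).
          apply HF; intros x Hx; simpl;
            replace (1 * val g x + -1 * val f x) with (val g x - val f x) by ring.
          -- assert (Rabs (val g x) <= INR M) by (apply (Hg1 ll M); simpl; auto).
             assert (Rabs (val f x) <= INR M) by auto.
             eapply Rle_trans; [apply Rabs_triang|]. rewrite Rabs_Ropp. lra.
          -- apply Hq'; auto. intros y i j m Hin. apply Hg2. apply in_or_app; auto.
        * apply Hbq; auto. split; simpl.
          -- intros ll' M' Hin. apply Hg1. simpl; auto.
          -- intros y i j m Hin. apply Hg2. apply in_or_app; auto. }
  destruct Ht as [t [Ht1 [Ht2 Ht3]]]. exists t. split; auto. split; auto.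
  intros g Hg. apply Hl3. exact (Ht3 g Hg).
Qed.

Theorem theorem7p2 (X : Type) (op : (X -> Prop) -> Prop)
  (Htop : is_topology op) (Hcount : countable_type X)
  (Haleph : aleph0_space op) :
  aleph0_space (weak_topology_Cc op).
Proof.
  destruct Haleph as [_ [N0 [[N HN0] Hk0]]].
  (* The enumeration may list sets outside [N0]; a k-network remains one when enlarged. *)
  assert (HN : k_network op (fun A => exists n, N n = A)).
  { intros K U HK HU KU. destruct (Hk0 K U HK HU KU) as [l [Hl ?]].
    exists l. split; auto. }
  split; [apply weak_regular, Htop|].
  exists (fun A => exists t, weak_network op N t = A). split.
  - destruct (countable_enum (list (list (list nat) * nat) * list (X * (nat * nat * nat)))
      (nil, nil)) as [e He].
    { pose proof countable_nat as Hn.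
      apply countable_prod; apply countable_list; apply countable_prod; auto;
        repeat (apply countable_list || apply countable_prod); auto. }
    exists (fun n => weak_network op N (e n)).
    intros A [t <-]. destruct (He t) as [n <-]. eauto.
  - intros H U HH HU HUH.
    pose proof (weak_compact_bounded op H HH) as Hb.
    (* The point sets are weakly open and cover [H]; compactness selects finitely many of them. *)
    destruct (HH (fun W => exists t, W = point_set op (snd t) /\
      (forall g, H g -> bound_set op N (fst t) g) /\ (forall g, weak_network op N t g -> U g)))
      as [l [Hl1 Hl2]].
    + intros W [t [-> _]]. apply point_set_open, Htop.
    + intros f Hf.
      destruct (weak_network_local op Htop N HN Hcount H U f Hb HU Hf (HUH f Hf))
        as [t [Ht1 [Ht2 Ht3]]].
      exists (point_set op (snd t)). split; eauto.
    + assert (Hm : exists m, (forall A, In A m -> exists t, weak_network op N t = A) /\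
        (forall A, In A m -> forall g, A g -> U g) /\
        (forall W, In W l -> forall g, H g -> W g -> exists A, In A m /\ A g)).
      { clear Hl2. induction l as [|W l IH].
        - exists nil. split; [|split]; intros ? [].
        - destruct IH as [m [Hm1 [Hm2 Hm3]]]; [intros; apply Hl1; simpl; auto|].
          destruct (Hl1 W) as [t [HW [Ht1 Ht2]]]; [simpl; auto|].
          exists (weak_network op N t :: m). split; [|split].
          + intros A [<-|HA]; eauto.
          + intros A [<-|HA]; eauto.
          + intros W' [<-|HW'] g Hg Wg.
            (* The point condition is [Wg]; the bound condition holds because [g] is in [H]. *)
            * exists (weak_network op N t). split; [simpl; auto|].
              rewrite HW in Wg. split; auto.
            * destruct (Hm3 W' HW' g Hg Wg) as [A [? ?]]. exists A. simpl; auto. }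
      destruct Hm as [m [Hm1 [Hm2 Hm3]]]. exists m. split; [|split]; auto.
      intros g Hg. destruct (Hl2 g Hg) as [W [? ?]]. eauto.
Qed.
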